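(* There exist $k,n\in\mathbb{N}$ and $k$-tuples of self-adjoint matrices $a=(a_1,\dots,a_k),\ b=(b_1,\dots,b_k)\in\mathcal{M}_n^k$ such that for every $l\in\mathbb{N}$ and $h_1,\dots,h_l\in\mathrm{A}(K)$, if $G:K\to\mathcal{M}$ is the multivalued nc function defined by $$G(x)=\bigcap_{i=1}^l\{\alpha\in(\mathcal{M}_m)_{\mathrm{sa}}:\alpha\ge h_i(x)\}$$ for $m\in\mathbb{N}$ and $x\in K_m$, then $$\mathrm{tr}_n(G(a))\le\mathrm{tr}_n(G(b)),$$ but there does not exist a unital quantum channel (i.e. a trace-preserving unital completely positive map) $\Phi:\mathcal{M}_n\to\mathcal{M}_n$ such that $\Phi(b_i)=a_i$ for all $1\le i\le k$. Here $K$ is any closed nc $k$-ball containing $a$ and $b$.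
   Context: Conventions. Indices $m,n\le\infty$ range over $\{1,2,\dots\}\cup\{\infty\}$. For each $n\le\infty$ fix a complex Hilbert space $H_n$ of dimension $n$ ($H_\infty$ of countably infinite dimension). $\mathcal{M}_{m,n}$ is the space of bounded operators $H_n\to H_m$ with the weak* topology (the norm topology if $m,n<\infty$); $\mathcal{M}_n=\mathcal{M}_{n,n}$ with identity $1_n$; $\mathcal{M}=\sqcup_{n\le\infty}\mathcal{M}_n$. The subscript sa denotes self-adjoint elements, and $\alpha\ge\beta$ means $\alpha-\beta$ is positive. $\mathcal{M}_n^k$ has the product topology, and $\alpha x\beta=(\alpha x_1\beta,\dots,\alpha x_k\beta)$ for $x\in\mathcal{M}_n^k$. For $n<\infty$, $\mathrm{tr}_n$ is the trace on $\mathcal{M}_n$ normalized by $\mathrm{tr}_n(1_n)=1$. Closed nc $k$-ball. For $r>0$, the closed nc $k$-ball of radius $r$ is $K=\sqcup_{n\le\infty}K_n$ with $K_n=\{x\in\mathcal{M}_n^k:\sum_{i=1}^k x_ix_i^*\le r^2 1_n\}$. Continuous affine nc functions. An affine nc function on $K$ is a function $f:K\to\mathcal{M}$ such that $f(K_n)\subseteq\mathcal{M}_n$ for all $n\le\infty$; $f(\sum_i\alpha_ix_i\alpha_i^* )=\sum_i\alpha_if(x_i)\alpha_i^*$ for every bounded sequence $x_i\in K_{n_i}$ and isometries $\alpha_i\in\mathcal{M}_{n,n_i}$ with $\sum_i\alpha_i\alpha_i^*=1_n$; and $f(\gamma^*x\gamma)=\gamma^*f(x)\gamma$ for all $x\in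 K_n$ and all isometries $\gamma\in\mathcal{M}_{n,m}$ (in particular all unitaries). It is continuous if $f|_{K_n}:K_n\to\mathcal{M}_n$ is continuous for every $n\le\infty$. $\mathrm{A}(K)$ is the space of continuous affine nc functions on $K$. A multivalued nc function $G:K\to\mathcal{M}$ assigns to each $x\in K_n$ a nonempty set $G(x)\subseteq(\mathcal{M}_n)_{\mathrm{sa}}$ which is unitarily equivariant ($G(\alpha^*x\alpha)=\alpha^*G(x)\alpha$ for unitary $\alpha\in\mathcal{M}_n$) and satisfies $G(x)=G(x)+\mathcal{M}_n^+$, where $\mathcal{M}_n^+$ is the set of positive elements of $\mathcal{M}_n$. $\mathrm{tr}_n(G(x))=\{\mathrm{tr}_n(\alpha):\alpha\in G(x)\}$, and for sets $S,T\subseteq\mathbb{R}$, $S\le T$ means that for every $\beta\in T$ there is $\alpha\in S$ with $\alpha\le\beta$. *)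

(* Defs.v *)
From HB Require Import structures.
From mathcomp Require Import all_boot all_order all_algebra.
From mathcomp Require Import mathcomp_extra boolp classical_sets functions.
From mathcomp Require Import reals topology normedtype sequences complex.
From mathcomp Require Import ring lra.

Set Implicit Arguments.
Unset Strict Implicit.
Unset Printing Implicit Defensive.
Import Order.TTheory GRing.Theory Num.Theory.
Import numFieldNormedType.Exports.

Local Open Scope classical_set_scope.
Local Open Scope ring_scope.
Local Open Scope complex_scope.

HB.mixin Record isHilbert (R : realType) V
    of CompleteNormedModule (R[i] : numFieldType) V := {
  inner : {dot V for (@Num.conj R[i])};
  inner_norm : forall u : V, inner u u = `|u| ^+ 2
}.

#[short(type="hilbertType")]
HB.structure Definition Hilbert (R : realType) :=
  {V of isHilbert R V & CompleteNormedModule (R[i] : numFieldType) V}.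

Notation "'<[ u , v ]>" := (inner u v) : ring_scope.

Section Riesz.
Variables (R : realType) (U : hilbertType R).
Local Notation C := (R[i] : numFieldType).
Implicit Types (u v w : U).

Lemma innerC u v : '<[u, v]> = Num.conj '<[v, u]>.
Proof. by rewrite hermC expr0 mul1r. Qed.

Lemma inner_ge0 u : 0 <= '<[u, u]>.
Proof. by rewrite inner_norm exprn_ge0. Qed.

Lemma inner_proj u v : v != 0 -> let t := '<[u, v]> / '<[v, v]> in
  '<[u - t *: v, u - t *: v]> = '<[u, u]> - `|'<[u, v]>| ^+ 2 / '<[v, v]>.
Proof.
move=> v0 t; have vv0 : '<[v, v]> != 0.
  by rewrite inner_norm expf_neq0 // normr_eq0.
have vvr : Num.conj '<[v, v]> = '<[v, v]> by rewrite -innerC.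
set x := `|_| ^+ 2 / _.
have d1 : '<[u, t *: v]> = x.
  rewrite linearZr_LR /= rmorphM /= fmorphV /= vvr /x normCK.
  by rewrite mulrAC [_ * '<[u, v]>]mulrC.
have d2 : Num.conj x = x.
  by rewrite /x rmorphM /= fmorphV /= vvr normCK rmorphM /= conjCK [_ * '<[u, v]>]mulrC.
rewrite dnormB dnormZ d1 d2 /t normrM exprMn normfV (ger0_norm (inner_ge0 v)).
rewrite expr2 -!mulrA mulVf // mulr1 mulrA -expr2 -/x.
by rewrite opprD addrA addrK.
Qed.

Lemma inner_cauchy u v : `|'<[u, v]>| <= `|u| * `|v|.
Proof.
have [->|v0] := eqVneq v 0; first by rewrite linear0r !normr0 mulr0.
have vv0 : 0 < '<[v, v]> by rewrite inner_norm exprn_gt0 // normr_gt0.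
have := inner_ge0 (u - ('<[u, v]> / '<[v, v]>) *: v).
rewrite inner_proj // subr_ge0 ler_pdivrMr // !inner_norm -exprMn.
by rewrite ler_pXn2r // nnegrE ?mulr_ge0.
Qed.

Lemma riesz (phi : U -> R[i]) (c : R[i]) : linear_for *%R phi -> 0 <= c ->
  (forall u, `|phi u| <= c * `|u|) -> exists w, forall u, phi u = '<[u, w]>.
Proof.
move=> lphi c0 phic.
have phi0 : phi 0 = 0 by have := lphi (-1) 0 0; rewrite scaler0 addr0 mulN1r addNr.
have phiZ a u : phi (a *: u) = a * phi u by have := lphi a u 0; rewrite phi0 !addr0.
have phiD u v : phi (u + v) = phi u + phi v.
  by have := lphi 1 u v; rewrite scale1r mul1r.
have phiB u v : phi (u - v) = phi u - phi v.
  by rewrite phiD -scaleN1r phiZ mulN1r.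
have [[u0 u0P]|phiz] := pselect (exists u, phi u != 0); last first.
  exists 0 => u; rewrite linear0r; apply/eqP/negPn/negP => un.
  by apply: phiz; exists u.
pose A := [set u | phi u = 1].
have A1 : A ((phi u0)^-1 *: u0) by rewrite /A /= phiZ mulVf.
pose N u : R := complex.Re (`|u| ^+ 2).
have NE u : (N u)%:C = `|u| ^+ 2.
  by rewrite /N RRe_real // ger0_real // exprn_ge0.
pose E := N @` A; pose m := inf E.
have E0 : has_inf E.
  split; first by exists (N ((phi u0)^-1 *: u0)); exists ((phi u0)^-1 *: u0).
  exists 0 => _ [u _ <-]; rewrite -(@lecR R) NE; exact: exprn_ge0.
have mle u : A u -> m%:C <= `|u| ^+ 2.
  move=> Au; rewrite -NE lecR; apply: ge_inf; last by exists u.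
  by case: E0.
pose D (d : R) := [set u | A u /\ `|u| ^+ 2 <= m%:C + d%:C].
pose F := filter_from [set d : R | 0 < d] D.
have FF : ProperFilter F.
  apply: filter_from_proper; last first.
    move=> d /= d0; have [_ [u Au <-] ud] := inf_adherent d0 E0.
    by exists u; split => //; rewrite -NE -rmorphD /= lecR; exact: ltW.
  apply: filter_from_filter; first by exists 1 => /=.
  move=> a b /= a0 b0; exists (Num.min a b); first by rewrite /= lt_min a0.
  move=> u [Au um]; split; split=> //; apply: (le_trans um).
    by rewrite lerD2l lecR ge_min lexx.
  by rewrite lerD2l lecR ge_min lexx orbT.
have close d u v : D d u -> D d v -> `|u - v| ^+ 2 <= 4 * d%:C.
  move=> [Au ud] [Av vd].
  have Auv : A (2^-1 *: (u + v)).
    by rewrite /A /= phiZ phiD Au Av mulVf // pnatr_eq0.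
  have := mle _ Auv; rewrite -inner_norm dnormZ normfV normr_nat => h1.
  have h2 : 4 * m%:C <= '<[u + v, u + v]>.
    rewrite mulrC -ler_pdivlMr ?ltr0n // mulrC; apply: (le_trans h1).
    by rewrite exprVn -natrX.
  have pl : '<[u + v, u + v]> + '<[u - v, u - v]> = 2 * '<[u, u]> + 2 * '<[v, v]>.
    rewrite dnormD dnormB addrACA subrr addr0.
    by rewrite -[RHS]mulrDr mulr_natl mulr2n.
  rewrite -inner_norm -(lerD2l '<[u + v, u + v]>) pl !inner_norm.
  apply: (@le_trans _ _ (4 * m%:C + 4 * d%:C)); last by rewrite lerD2r -inner_norm.
  have -> : 4 * m%:C + 4 * d%:C = 2 * (m%:C + d%:C) + 2 * (m%:C + d%:C) by ring.
  by rewrite lerD // ler_pM2l // ltr0n.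
have Fc : cauchy F.
  apply: cauchy_exP => e /= e0.
  have er : e \is Num.real by rewrite ger0_real // ltW.
  have e'0 : 0 < complex.Re e by rewrite -(@ltcR R) RRe_real.
  pose d := (complex.Re e) ^+ 2 / 8.
  have d0 : 0 < d by rewrite divr_gt0 // ?exprn_gt0 // ltr0n.
  have [u Du] : D d !=set0 by apply: (@filter_ex _ F); exists d.
  exists u; exists d => // v Dv; rewrite -ball_normE /ball_ /=.
  rewrite -(@ltr_pXn2r _ 2) ?nnegrE // ?(ltW e0) //.
  apply: (le_lt_trans (close _ _ _ Du Dv)).
  have -> : 4 * d%:C = e ^+ 2 / 2.
    rewrite /d rmorphM rmorphXn /= RRe_real // fmorphV rmorph_nat.
    rewrite mulrCA; congr (_ * _).
    by field.
  by rewrite ltr_pdivrMr ?ltr0n // ltr_pMr ?exprn_gt0 // ltr1n.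
have /cvg_ex[z Fz] := @cauchy_cvg U F FF Fc.
have near_z (d : R) : 0 < d -> exists2 u, D d u & `|z - u| <= d%:C.
  move=> d0; have d0' : 0 < d%:C by rewrite ltcR.
  have B : F (D d `&` ball z d%:C).
    by apply: filterI; [exists d|apply: Fz; exact: nbhsx_ballx].
  have [u [Du]] := filter_ex B.
  by rewrite -ball_normE /= => /ltW; exists u.
have sqz (a b : R[i]) : 0 <= a -> 0 <= b ->
    (forall d : R, 0 < d -> d <= 1 -> a ^+ 2 <= d%:C * b) -> a = 0.
  move=> a0 b0 h; apply/eqP; rewrite -sqrf_eq0; apply/eqP/le_anti.
  rewrite exprn_ge0 // andbT.
  have ar : a ^+ 2 \is Num.real by rewrite ger0_real // exprn_ge0.
  have br : b \is Num.real by rewrite ger0_real.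
  rewrite -(RRe_real ar) -(@rmorph0 _ _ (real_complex R)) lecR leNgt.
  apply/negP => p0.
  set p := complex.Re (a ^+ 2) in p0; set q := complex.Re b.
  have q0 : 0 <= q by rewrite -(@lecR R) RRe_real.
  pose d := Num.min 1 (p / (q + 1) / 2).
  have pq : 0 < p / (q + 1) by rewrite divr_gt0 // ltr_wpDl.
  have d0 : 0 < d by rewrite /d lt_min ltr01 /= divr_gt0 // ltr0n.
  have := h d d0 _; rewrite /d ge_min lexx => /(_ isT).
  rewrite -(RRe_real ar) -(RRe_real br) -rmorphM /= lecR -/p -/q leNgt => /negP; apply.
  apply: (@le_lt_trans _ _ (p / (q + 1) / 2 * q)).
    by rewrite ler_wpM2r // ge_min lexx orbT.
  rewrite mulrAC ltr_pdivrMr ?ltr0n // mulrAC ltr_pdivrMr ?ltr_wpDl //.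
  by rewrite -mulrA ltr_pM2l //; lra.
have phiz1 : phi z = 1.
  apply/eqP; rewrite -subr_eq0 -normr_eq0; apply/eqP.
  apply: (sqz _ (c ^+ 2)) => //; first by rewrite exprn_ge0.
  move=> d d0 d1; have [u [Au _] zu] := near_z d d0.
  have -> : phi z - 1 = phi (z - u) by rewrite phiB Au.
  apply: (@le_trans _ _ ((c * d%:C) ^+ 2)).
    rewrite ler_pXn2r ?nnegrE // ?mulr_ge0 // ?ler0c ?(ltW d0) //.
    by rewrite (le_trans (phic _)) // ler_wpM2l.
  rewrite exprMn mulrC ler_wpM2r ?exprn_ge0 //.
  by rewrite -rmorphXn lecR expr2 ler_piMl // ltW.
have zorth h : phi h = 0 -> '<[h, z]> = 0.
  move=> h0; rewrite innerC; apply/eqP; rewrite conjC_eq0 -normr_eq0; apply/eqP.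
  have [->|hn0] := eqVneq h 0; first by rewrite linear0r normr0.
  apply: (sqz _ (4 * `|h| ^+ 2)) => //; first by rewrite mulr_ge0 ?exprn_ge0.
  move=> d d0 d1; have [u [Au ud] zu] := near_z d d0.
  have hh0 : 0 < '<[h, h]> by rewrite inner_norm exprn_gt0 // normr_gt0.
  have uh : `|'<[u, h]>| ^+ 2 <= d%:C * `|h| ^+ 2.
    have : A (u - ('<[u, h]> / '<[h, h]>) *: h).
      by rewrite /A /= phiB phiZ h0 mulr0 subr0.
    move=> /mle; rewrite -inner_norm inner_proj // => mu.
    have : m%:C <= m%:C + d%:C - `|'<[u, h]>| ^+ 2 / '<[h, h]>.
      by apply: (le_trans mu); rewrite lerD2r inner_norm.
    by rewrite -addrA lerDl subr_ge0 ler_pdivrMr // inner_norm.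
  have -> : '<[z, h]> = '<[z - u, h]> + '<[u, h]> by rewrite linearBl /= subrK.
  have zuh : `|'<[z - u, h]>| ^+ 2 <= d%:C * `|h| ^+ 2.
    apply: (@le_trans _ _ ((d%:C * `|h|) ^+ 2)).
      rewrite ler_pXn2r ?nnegrE // ?mulr_ge0 // ?ler0c ?(ltW d0) //.
      by rewrite (le_trans (inner_cauchy _ _)) // ler_wpM2r.
    rewrite exprMn ler_wpM2r ?exprn_ge0 //.
    by rewrite -rmorphXn lecR expr2 ler_piMl // ltW.
  set p := '<[z - u, h]> in zuh *; set q := '<[u, h]> in uh *.
  have pq : `|p + q| ^+ 2 <= 2 * `|p| ^+ 2 + 2 * `|q| ^+ 2.
    apply: (@le_trans _ _ ((`|p| + `|q|) ^+ 2)).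
      by rewrite ler_pXn2r ?nnegrE // ?addr_ge0 // ler_normD.
    rewrite -subr_ge0 (_ : _ - _ = (`|p| - `|q|) ^+ 2).
      by rewrite real_exprn_even_ge0 // rpredB // normr_real.
    by ring.
  apply: (le_trans pq).
  have -> : d%:C * (4 * `|h| ^+ 2) = 2 * (d%:C * `|h| ^+ 2) + 2 * (d%:C * `|h| ^+ 2).
    by ring.
  by rewrite lerD // ler_pM2l // ltr0n.
have z0 : z != 0.
  by apply: contra_eq_neq phiz1 => ->; rewrite phi0 eq_sym oner_eq0.
exists ((`|z| ^- 2) *: z) => u.
have := zorth (u - phi u *: z); rewrite phiB phiZ phiz1 mulr1 subrr => /(_ erefl).
rewrite linearBl /= linearZl_LR /= => /eqP; rewrite subr_eq0 => /eqP uz.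
rewrite linearZr_LR /= uz inner_norm.
have -> : Num.conj (`|z| ^- 2) = `|z| ^- 2.
  by apply: conj_Creal; rewrite ger0_real // invr_ge0 exprn_ge0.
by rewrite mulrC mulfK // expf_neq0 // normr_eq0.
Qed.
End Riesz.

Section BoundedOperators.
Variables (R : realType) (U V : hilbertType R).
Local Notation C := (R[i] : numFieldType).

Definition bounded_linear : pred (U -> V) := fun f =>
  `[< linear f /\ exists2 c : C, 0 <= c & forall u, `|f u| <= c * `|u| >].

Lemma bounded_linear_submod : submod_closed bounded_linear.
Proof.
split.
  apply/asboolP; split; first by move=> a u v; rewrite /= scaler0 addr0.
  by exists 0 => // u; rewrite normr0 mul0r.
move=> a f g /asboolP[lf [c c0 fc]] /asboolP[lg [d d0 gd]].
apply/asboolP; split.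
  move=> b u v; rewrite !fctE /= lf lg !scalerDr !scalerA (mulrC a b) -!addrA.
  by congr (_ + _); rewrite addrCA.
exists (`|a| * c + d); first by rewrite addr_ge0 ?mulr_ge0.
move=> u; rewrite !fctE /= (le_trans (ler_normD _ _))// mulrDl lerD//.
by rewrite normrZ -mulrA ler_wpM2l.
Qed.

HB.instance Definition _ := GRing.isSubmodClosed.Build C (U -> V)
  bounded_linear bounded_linear_submod.

Record bop := Bop { bop_fun :> U -> V; bopP : bounded_linear bop_fun }.

HB.instance Definition _ := [isSub for bop_fun].
HB.instance Definition _ := [Choice of bop by <:].
HB.instance Definition _ := [SubChoice_isSubLmodule of bop by <:].

Lemma bop_linear (f : bop) : linear f.
Proof. by have /asboolP[] := bopP f. Qed.

HB.instance Definition _ (f : bop) :=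
  GRing.isLinear.Build C U V *:%R f (bop_linear f).

Lemma bop_eqP (S T : bop) : S = T <-> S =1 T.
Proof. by split=> [->//|ST]; apply/val_inj/funext. Qed.

End BoundedOperators.

Notation "''B' ( U , V )" := (bop U V) (format "''B' ( U ,  V )") : type_scope.
Notation "''B' ( U )" := (bop U U) (format "''B' ( U )") : type_scope.

Lemma bounded_linear_comp (R : realType) (U V W : hilbertType R)
  (S : 'B(V, W)) (T : 'B(U, V)) : bounded_linear (S \o T).
Proof.
have /asboolP[lS [c c0 Sc]] := bopP S; have /asboolP[lT [d d0 Td]] := bopP T.
apply/asboolP; split; first by move=> a u v /=; rewrite lT lS.
exists (c * d) => [|u /=]; first exact: mulr_ge0.
by rewrite (le_trans (Sc _))// -mulrA ler_wpM2l.
Qed.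

Definition bcomp (R : realType) (U V W : hilbertType R)
  (S : 'B(V, W)) (T : 'B(U, V)) : 'B(U, W) := Bop (bounded_linear_comp S T).
Notation "S \ob T" := (bcomp S T) (at level 40, left associativity) : ring_scope.

Lemma bounded_linear_id (R : realType) (U : hilbertType R) :
  bounded_linear (@id U).
Proof. by apply/asboolP; split=> //; exists 1 => // u; rewrite mul1r. Qed.

Definition bid (R : realType) (U : hilbertType R) : 'B(U) :=
  Bop (bounded_linear_id U).

(* The adjoint; [adjP] below shows that the chosen [S] exists. *)
Definition adj (R : realType) (U V : hilbertType R) (T : 'B(U, V)) : 'B(V, U) :=
  xget 0 [set S : 'B(V, U) | forall u v, '<[T u, v]> = '<[u, S v]>].

Lemma adjP (R : realType) (U V : hilbertType R) (T : 'B(U, V)) u v :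
  '<[T u, v]> = '<[u, adj T v]>.
Proof.
suff [S SP] : exists S : 'B(V, U), forall u v, '<[T u, v]> = '<[u, S v]>.
  by rewrite /adj; case: xgetP => [S' _ -> //|/(_ S)].
have /asboolP[_ [c c0 Tc]] := bopP T.
have /choice[s sP] : forall v, exists w, forall u, '<[T u, v]> = '<[u, w]>.
  move=> {u}v; apply: (@riesz _ _ (fun u => '<[T u, v]>) (c * `|v|)).
  - by move=> a u w; rewrite linearP linearDl /= linearZl_LR.
  - by rewrite mulr_ge0.
  - move=> u; rewrite (le_trans (inner_cauchy _ _)) // mulrAC.
    by rewrite ler_wpM2r.
have sinj w w' : (forall u, '<[u, w]> = '<[u, w']>) -> w = w'.
  move=> ww; apply/eqP; rewrite -subr_eq0 -normr_eq0 -sqrf_eq0.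
  by rewrite -inner_norm linearBr /= ww subrr.
suff bs : bounded_linear s by exists (Bop bs) => u' v'; exact: sP.
apply/asboolP; split.
  move=> a w w'; apply: sinj => x.
  by rewrite -sP !linearDr /= !linearZr_LR /= !sP.
exists c => // w; have [->|sw0] := eqVneq (s w) 0.
  by rewrite normr0 mulr_ge0.
rewrite -(@ler_pM2l _ `|s w|) ?normr_gt0 // -expr2 -inner_norm -sP.
have := inner_cauchy (T (s w)) w.
rewrite sP inner_norm ger0_norm ?exprn_ge0 // => /le_trans; apply.
by rewrite mulrA ler_wpM2r // mulrC; exact: Tc.
Qed.

Definition selfadj (R : realType) (U : hilbertType R) (T : 'B(U)) := adj T = T.

Definition isom (R : realType) (U V : hilbertType R) (T : 'B(U, V)) :=
  adj T \ob T = bid U.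

Definition unitary (R : realType) (U : hilbertType R) (T : 'B(U)) :=
  adj T \ob T = bid U /\ T \ob adj T = bid U.

(* In [R[i]], [0 <= z] includes that [z] is real. *)
Definition posop (R : realType) (U : hilbertType R) (T : 'B(U)) :=
  forall u, 0 <= '<[T u, u]>.

Definition le_op (R : realType) (U : hilbertType R) (S T : 'B(U)) :=
  posop (T - S).

(* B(U, V) is the dual of the trace class operators, which are the sums of the
   rank one operators |xi_j><eta_j| for square summable xi and eta. So the weak*
   topology is the initial topology of the functionals
   T |-> sum_j <T xi_j, eta_j>. In finite dimension it is the norm topology. *)
Section WeakStar.
Variables (R : realType) (U V : hilbertType R).
Local Notation C := (R[i] : numFieldType).

Definition square_summable (W : hilbertType R) (xi : nat -> W) :=
  cvgn (series (fun j => `|xi j| ^+ 2) : nat -> C).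

Definition predual :=
  {p : (nat -> U) * (nat -> V) | square_summable p.1 /\ square_summable p.2}.

Definition predual_pairing (T : 'B(U, V)) : {ptws predual -> C} := fun p =>
  limn (series (fun j => '<[T ((sval p).1 j), (sval p).2 j]>) : nat -> C).

HB.instance Definition _ :=
  Topological.copy 'B(U, V) (initial_topology predual_pairing).

End WeakStar.

Definition hilbert_basis (R : realType) (U : hilbertType R) (I : eqType)
    (e : I -> U) :=
  (forall i j, '<[e i, e j]> = (i == j)%:R) /\
  (forall u, (forall i, '<[u, e i]> = 0) -> u = 0).

(* The dimensions {1, 2, ...} and infinity: [Fin d] stands for [d.+1]. *)
Inductive dimn := Fin of nat | Infty.

Definition basis_index (n : dimn) : eqType :=
  if n is Fin d then 'I_d.+1 else nat.

Section NcBall.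
Variables (R : realType) (H : dimn -> hilbertType R) (k : nat).
Implicit Types (r : R) (n m : dimn).

Definition nctuple n := {ptws 'I_k -> 'B(H n)}.

Definition conj_tuple n m (al : 'B(H n, H m)) (x : nctuple n)
  (be : 'B(H m, H n)) : nctuple m := fun j => al \ob x j \ob be.

Definition nc_ball r n : set (nctuple n) :=
  [set x | le_op (\sum_j x j \ob adj (x j)) ((r ^+ 2)%:C *: bid (H n))].

Definition ncfun := forall n, nctuple n -> 'B(H n).

(* The index set P makes the sequence (x_i) finite or infinite; infinite sums
   are weak* limits of partial sums. *)
Definition preserves_nc_combinations r (f : ncfun) :=
  forall n (P : pred nat) (d : nat -> dimn) (x : forall i, nctuple (d i))
    (al : forall i, 'B(H (d i), H n)) (y : nctuple n),
  (forall i, P i -> nc_ball r (x i)) ->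
  (exists c : R[i], forall i j u, P i -> `|x i j u| <= c * `|u|) ->
  (forall i, P i -> isom (al i)) ->
  (fun N => \sum_(i < N | P i) al i \ob adj (al i)) @ \oo --> bid (H n) ->
  (forall j, (fun N => \sum_(i < N | P i)
     conj_tuple (al i) (x i) (adj (al i)) j) @ \oo --> y j) ->
  (fun N => \sum_(i < N | P i) al i \ob f (d i) (x i) \ob adj (al i)) @ \oo
    --> f n y.

Definition preserves_compressions r (f : ncfun) :=
  forall n m (ga : 'B(H m, H n)) (x : nctuple n), isom ga -> nc_ball r x ->
  f m (conj_tuple (adj ga) x ga) = adj ga \ob f n x \ob ga.

(* A(K) for K the closed nc k-ball of radius r. An [ncfun] is total, but only
   its values on K are constrained. *)
Definition cont_affine r : set ncfun := [set f |
  [/\ preserves_nc_combinations r f, preserves_compressions r f &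
      forall n, {within @nc_ball r n, continuous (f n)}]].

Definition mvfun := forall n, nctuple n -> set 'B(H n).

Definition multivalued_nc r (G : mvfun) := forall n (x : nctuple n),
  nc_ball r x ->
  [/\ G n x !=set0,
      G n x `<=` @selfadj R (H n),
      forall al : 'B(H n), unitary al ->
        G n (conj_tuple (adj al) x al) =
        [set adj al \ob be \ob al | be in G n x] &
      G n x = [set be + p | be in G n x & p in @posop R (H n)]].

End NcBall.

Section FiniteLevel.
Variables (R : realType) (H : hilbertType R) (d : nat) (e : 'I_d -> H).

(* Normalized trace, when [e] is an orthonormal basis of [H] (d > 0). *)
Definition ntrace (T : 'B(H)) : R[i] := d%:R^-1 * \sum_i '<[T (e i), e i]>.

(* Positivity in M_p(B(H)), seen as B(H^p). *)
Definition posmx p (T : 'I_p -> 'I_p -> 'B(H)) := forall u : 'I_p -> H,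
  0 <= \sum_i \sum_j '<[T i j (u j), u i]>.

Definition completely_positive (Phi : 'B(H) -> 'B(H)) :=
  forall p (T : 'I_p -> 'I_p -> 'B(H)), posmx T -> posmx (fun i j => Phi (T i j)).

Definition unital_quantum_channel (Phi : 'B(H) -> 'B(H)) :=
  [/\ linear Phi, completely_positive Phi,
      forall T, ntrace (Phi T) = ntrace T & Phi (bid H) = bid H].

End FiniteLevel.

Definition le_set (R : numDomainType) (S T : set R) :=
  forall be, T be -> exists2 al, S al & al <= be.

(* Main.v *)
Require Import Defs.
From mathcomp Require Import all_boot all_order all_algebra.
From mathcomp Require Import mathcomp_extra boolp classical_sets functions.
From mathcomp Require Import reals topology normedtype sequences complex.

(** The counterexample is the transpose map: it is positive, unital and trace
preserving, but not completely positive.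

An affine nc function [h] commutes with compressions to [H_1], so that for a
unit vector [u], [<h(x) u, u>] depends only on the scalars [<x_j u, u>]
([compression_form]): [h] cannot see anything beyond the joint numerical range
of [x].  Fix an orthonormal basis of [H_n] and let [J] be the associated complex
conjugation.  For self-adjoint [T], the operator [J T J] is the transpose of
[T], and [<J T J u, u> = <T (J u), J u>] ([conj_op_form]).  So if the [b_j] are
self-adjoint and [a_j = J b_j J], then
[<h(a) u, u> = <h(b) (J u), J u>], and [al >= h_i(b)] implies
[J al J >= h_i(a)] ([le_op_conj_op]).  As [J al J] has the same trace as [al],
this gives [tr (G(a)) <= tr (G(b))].

Now take [n = 2] and let [b] consist of four self-adjoint matrices that span
[M_2], so that [a] is the tuple of their transposes.  A linear map that sends
[b] to [a] is the transpose map, whose Choi matrix is not positive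
([swap_not_completely_positive]). *)

Set Implicit Arguments.
Unset Strict Implicit.
Unset Printing Implicit Defensive.
Import Order.TTheory GRing.Theory Num.Theory.
Import numFieldNormedType.Exports.

Local Open Scope classical_set_scope.
Local Open Scope ring_scope.

(** * Adjoints and rank one operators *)

Lemma inner_inj (R : realType) (U : hilbertType R) (w w' : U) :
  (forall u, '<[u, w]> = '<[u, w']>) -> w = w'.
Proof.
move=> ww; apply/eqP; rewrite -subr_eq0 -normr_eq0 -sqrf_eq0.
by rewrite -inner_norm linearBr /= ww subrr.
Qed.

Lemma innerDl (R : realType) (U : hilbertType R) (u v w : U) :
  '<[u + v, w]> = '<[u, w]> + '<[v, w]>.
Proof. by rewrite linearDl. Qed.

Lemma innerDr (R : realType) (U : hilbertType R) (u v w : U) :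
  '<[w, u + v]> = '<[w, u]> + '<[w, v]>.
Proof. by rewrite linearDr. Qed.

Lemma innerZl (R : realType) (U : hilbertType R) c (u v : U) :
  '<[c *: u, v]> = c * '<[u, v]>.
Proof. by rewrite linearZl_LR. Qed.

Lemma innerZr (R : realType) (U : hilbertType R) c (u v : U) :
  '<[u, c *: v]> = Num.conj c * '<[u, v]>.
Proof. by rewrite linearZr_LR. Qed.

Lemma adj_unique (R : realType) (U V : hilbertType R) (T : 'B(U, V))
    (S : 'B(V, U)) :
  (forall u v, '<[T u, v]> = '<[u, S v]>) -> adj T = S.
Proof.
by move=> TS; apply/bop_eqP => v; apply: inner_inj => u; rewrite -adjP TS.
Qed.

Lemma selfadjP (R : realType) (U : hilbertType R) (T : 'B(U)) :
  selfadj T <-> forall u v, '<[T u, v]> = '<[u, T v]>.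
Proof.
split=> [sT u v|]; first by rewrite adjP sT.
exact: adj_unique.
Qed.

Lemma selfadj_conj (R : realType) (U : hilbertType R) (T : 'B(U)) u v :
  selfadj T -> Num.conj '<[T u, v]> = '<[T v, u]>.
Proof. by move=> /selfadjP sT; rewrite -innerC sT. Qed.

Lemma bounded_linear_ketbra (R : realType) (U V : hilbertType R)
    (w : V) (v : U) : bounded_linear (fun x : U => '<[x, v]> *: w).
Proof.
apply/asboolP; split.
  by move=> c x y; rewrite linearDl /= linearZl_LR scalerDl scalerA.
exists (`|v| * `|w|) => [|x]; first by rewrite mulr_ge0.
rewrite normrZ mulrAC ler_wpM2r // mulrC; exact: inner_cauchy.
Qed.

Lemma bopD (R : realType) (U V : hilbertType R) (S T : 'B(U, V)) (u : U) :
  (S + T) u = S u + T u.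
Proof. by []. Qed.

Lemma bopZ (R : realType) (U V : hilbertType R) c (T : 'B(U, V)) (u : U) :
  (c *: T) u = c *: T u.
Proof. by []. Qed.

(** The rank one operator [|w><v|]. *)
Definition ketbra (R : realType) (U V : hilbertType R) (w : V) (v : U) :
  'B(U, V) := Bop (bounded_linear_ketbra w v).

Lemma ketbraE (R : realType) (U V : hilbertType R) (w : V) (v x : U) :
  ketbra w v x = '<[x, v]> *: w.
Proof. by []. Qed.

Lemma adj_ketbra (R : realType) (U V : hilbertType R) (w : V) (v : U) :
  adj (ketbra w v) = ketbra v w.
Proof.
apply: adj_unique => x y; rewrite !ketbraE linearZl_LR linearZr_LR /=.
by rewrite -innerC mulrC.
Qed.

Lemma compression_ketbra (R : realType) (U V : hilbertType R) (T : 'B(U))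
    (u : U) (v : V) :
  adj (ketbra u v) \ob T \ob ketbra u v = '<[T u, u]> *: ketbra v v.
Proof.
apply/bop_eqP => x; rewrite adj_ketbra /= linearZ /=.
by rewrite linearZl_LR /= mulrC -scalerA.
Qed.

(** * Bases and complex conjugation *)

Lemma hilbert_basis_sum (R : realType) (U : hilbertType R) (d : nat)
    (e : 'I_d -> U) (u : U) : hilbert_basis e ->
  u = \sum_i '<[u, e i]> *: e i.
Proof.
move=> [eo ec]; apply/eqP; rewrite -subr_eq0; apply/eqP/ec => j.
rewrite linearBl /= linear_sumlz /= (bigD1 j) //= linearZl_LR /= eo eqxx mulr1.
rewrite big1 ?addr0 ?subrr // => i ij.
by rewrite linearZl_LR /= eo (negbTE ij) mulr0.
Qed.

(** An isometry from a one-dimensional space is the choice of a unit vector. *)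
Lemma isom_ketbra (R : realType) (U V : hilbertType R) (e : 'I_1 -> V)
    (u : U) : hilbert_basis e -> '<[u, u]> = 1 -> isom (ketbra u (e ord0)).
Proof.
move=> eB u1; apply/bop_eqP => x; rewrite adj_ketbra /=.
rewrite linearZl_LR /= u1 mulr1 [RHS](hilbert_basis_sum _ eB).
by rewrite big_ord1.
Qed.

(** The complex conjugation of the coordinates in the basis [e]. *)
Definition conjv (R : realType) (U : hilbertType R) (d : nat) (e : 'I_d -> U)
  (u : U) : U := \sum_i Num.conj '<[u, e i]> *: e i.

Section Conjugation.
Variables (R : realType) (U : hilbertType R) (d : nat) (e : 'I_d -> U).
Hypothesis eB : hilbert_basis e.
Local Notation J := (conjv e).

Lemma conjvP c u v : J (c *: u + v) = Num.conj c *: J u + J v.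
Proof.
rewrite /conjv scaler_sumr -big_split /=; apply: eq_bigr => i _.
by rewrite linearDl /= linearZl_LR /= rmorphD rmorphM /= scalerDl scalerA.
Qed.

Lemma conjv0 : J 0 = 0.
Proof.
by have := conjvP (-1) 0 0; rewrite scaler0 addr0 rmorphN1 scaleN1r addNr.
Qed.

Lemma conjvC u v : '<[J u, v]> = '<[J v, u]>.
Proof.
rewrite /conjv !linear_sumlz /=; apply: eq_bigr => i _.
by rewrite !linearZl_LR /= -!innerC mulrC.
Qed.

Lemma inner_conjv u i : '<[J u, e i]> = Num.conj '<[u, e i]>.
Proof.
rewrite /conjv linear_sumlz /= (bigD1 i) //= linearZl_LR /= (proj1 eB) eqxx.
rewrite mulr1 big1 ?addr0 // => j ji.
by rewrite linearZl_LR /= (proj1 eB) (negbTE ji) mulr0.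
Qed.

Lemma conjvK u : J (J u) = u.
Proof.
rewrite [RHS](hilbert_basis_sum _ eB); apply: eq_bigr => i _.
by rewrite inner_conjv conjCK.
Qed.

Lemma conjv_basis i : J (e i) = e i.
Proof.
rewrite [RHS](hilbert_basis_sum _ eB); apply: eq_bigr => j _.
by rewrite (proj1 eB) rmorph_nat.
Qed.

Lemma inner_conjv2 u : '<[J u, J u]> = '<[u, u]>.
Proof. by rewrite conjvC conjvK. Qed.

Lemma norm_conjv u : `|J u| = `|u|.
Proof.
by apply/eqP; rewrite -(@eqrXn2 _ 2) // -!inner_norm inner_conjv2.
Qed.

Lemma bounded_linear_conj_op (T : 'B(U)) : bounded_linear (J \o T \o J).
Proof.
have /asboolP[_ [c c0 Tc]] := bopP T.
apply/asboolP; split.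
  by move=> a u v /=; rewrite conjvP linearP conjvP conjCK.
by exists c => // u /=; rewrite norm_conjv (le_trans (Tc _)) // norm_conjv.
Qed.

(** The operator [J T J], whose matrix in the basis [e] is the entrywise
conjugate of that of [T], hence its transpose when [T] is self-adjoint. *)
Definition conj_op (T : 'B(U)) : 'B(U) := Bop (bounded_linear_conj_op T).

Lemma inner_conj_op T u v : '<[conj_op T u, v]> = Num.conj '<[T (J u), J v]>.
Proof. by rewrite /= conjvC innerC. Qed.

Lemma conj_op_selfadj T : selfadj T -> selfadj (conj_op T).
Proof.
move=> sT; apply/selfadjP => u v; rewrite inner_conj_op selfadj_conj //.
by rewrite [RHS]innerC inner_conj_op conjCK.
Qed.

Lemma conj_op_form T u : selfadj T ->
  '<[conj_op T u, u]> = '<[T (J u), J u]>.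
Proof. by move=> sT; rewrite inner_conj_op selfadj_conj. Qed.

Lemma ntrace_conj_op T : selfadj T -> ntrace e (conj_op T) = ntrace e T.
Proof.
move=> sT; congr (_ * _); apply: eq_bigr => i _.
by rewrite conj_op_form // conjv_basis.
Qed.

Lemma conj_opP c S T :
  conj_op (c *: S + T) = Num.conj c *: conj_op S + conj_op T.
Proof. by apply/bop_eqP => u /=; rewrite conjvP. Qed.

Lemma conj_op_ketbra i j : conj_op (ketbra (e i) (e j)) = ketbra (e i) (e j).
Proof.
apply/bop_eqP => u; rewrite /= inner_conjv -[_ *: e i]addr0 conjvP conjCK.
by rewrite conjv_basis conjv0 addr0.
Qed.

End Conjugation.

(** * Affine nc functions and the numerical range *)

(** The quadratic form of [f x] at [u] is determined by the values of the
quadratic forms of the [x j] at [u]: after scaling [u] to a unit vector, both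
are compressions to the one-dimensional level. *)
Lemma compression_form (R : realType) (H : dimn -> hilbertType R) (k : nat)
    (e1 : 'I_1 -> H (Fin 0)) (r : R) (f : ncfun H k) (n m : dimn)
    (x : nctuple H k n) (y : nctuple H k m) (u : H n) (v : H m) :
  hilbert_basis e1 -> preserves_compressions r f ->
  nc_ball r x -> nc_ball r y -> '<[u, u]> = '<[v, v]> ->
  (forall j, '<[x j u, u]> = '<[y j v, v]>) ->
  '<[f n x u, u]> = '<[f m y v, v]>.
Proof.
move=> eB fc xr yr uv xy.
have [u0|u0] := eqVneq u 0.
  have v0 : v = 0.
    apply/eqP; rewrite -normr_eq0 -sqrf_eq0 -inner_norm -uv u0.
    by rewrite linear0l.
  by rewrite u0 v0 !linear0r.
pose c := `|u|^-1; have nu0 : `|u| != 0 by rewrite normr_eq0.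
have c0 : c != 0 by rewrite invr_eq0.
have cc : Num.conj c = c by apply: conj_Creal; rewrite ger0_real ?invr_ge0.
have formZ p (T : 'B(H p)) w :
    '<[T (c *: w), c *: w]> = c ^+ 2 * '<[T w, w]>.
  by rewrite linearZr_LR /= linearZ linearZl_LR /= cc mulrA expr2.
have unit_cu : '<[c *: u, c *: u]> = 1.
  by rewrite (formZ n (bid (H n))) inner_norm -exprMn mulVf ?expr1n.
have unit_cv : '<[c *: v, c *: v]> = 1.
  by rewrite -unit_cu (formZ n (bid (H n))) (formZ m (bid (H m))) /= uv.
pose ga := ketbra (c *: u) (e1 ord0); pose de := ketbra (c *: v) (e1 ord0).
have same : conj_tuple (adj ga) x ga = conj_tuple (adj de) y de.
  apply/funext => j; rewrite /conj_tuple !compression_ketbra.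
  by rewrite !formZ xy.
have := fc _ _ de y (isom_ketbra eB unit_cv) yr.
rewrite -same (fc _ _ ga x (isom_ketbra eB unit_cu) xr) !compression_ketbra.
move=> /bop_eqP/(_ (e1 ord0)) /= /(congr1 (fun w => '<[w, e1 ord0]>)).
rewrite !linearZl_LR /= !(proj1 eB) eqxx !mulr1 !formZ => /mulfI; apply.
by rewrite expf_neq0.
Qed.

(** For an affine nc function [h], [al >= h(b)] implies [J al J >= h(a)] when
[a] is the transpose of a self-adjoint tuple [b]. *)
Lemma le_op_conj_op (R : realType) (H : dimn -> hilbertType R) (k d : nat)
    (e1 : 'I_1 -> H (Fin 0)) (e : 'I_d.+1 -> H (Fin d))
    (eB : hilbert_basis e) (r : R) (h : ncfun H k)
    (a b : nctuple H k (Fin d)) (al : 'B(H (Fin d))) :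
  hilbert_basis e1 -> preserves_compressions r h ->
  nc_ball r a -> nc_ball r b ->
  (forall j, selfadj (b j)) -> (forall j, a j = conj_op eB (b j)) ->
  selfadj al -> le_op (h (Fin d) b) al ->
  le_op (h (Fin d) a) (conj_op eB al).
Proof.
move=> e1B hc ar br sb ab sal hal u.
have -> : '<[(conj_op eB al - h (Fin d) a) u, u]> =
    '<[(al - h (Fin d) b) (conjv e u), conjv e u]>; last exact: hal.
rewrite [LHS]linearBl [RHS]linearBl /=; congr (_ - _).
  exact: conj_op_form.
apply: (compression_form e1B hc ar br) => [|j]; first by rewrite inner_conjv2.
by rewrite ab conj_op_form.
Qed.

(** * The transpose map is not completely positive *)

Section Transpose.
Variables (R : realType) (U : hilbertType R) (e : 'I_2 -> U).
Hypothesis eB : hilbert_basis e.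
Local Notation E i j := (ketbra (e i) (e j)).

Lemma posmx_units : posmx (fun i j : 'I_2 => E i j).
Proof.
move=> u; pose s := \sum_j '<[u j, e j]>.
have -> : \sum_i \sum_j '<[E i j (u j), u i]> = s * Num.conj s.
  rewrite /s rmorph_sum mulr_sumr; apply: eq_bigr => i _.
  rewrite mulr_suml; apply: eq_bigr => j _.
  by rewrite ketbraE linearZl_LR /= -innerC.
exact: mul_conjC_ge0.
Qed.

(** The Choi matrix of the transpose map is the swap of [U (x) U], which
has eigenvalue [-1] on antisymmetric tensors. *)
Lemma swap_not_completely_positive (Phi : 'B(U) -> 'B(U)) :
  (forall i j, Phi (E i j) = E j i) -> ~ completely_positive Phi.
Proof.
move=> PhiE /(_ _ _ posmx_units).
(* The antisymmetric tensor [e 0 (x) e 1 - e 1 (x) e 0]. *)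
move=> /(_ (fun i => if i == 0 then e 1 else - e 0)).
rewrite !big_ord_recl !big_ord0 !PhiE !ketbraE /=.
have -> : lift ord0 ord0 = 1 :> 'I_2 by apply: val_inj.
rewrite !linearZl_LR /= !linearNl /= !linearNr /= !(proj1 eB) /=.
rewrite !(mulr0, mul0r, addr0, add0r, oppr0, mulr1, mul1r, mulrN).
by rewrite -opprD oppr_ge0 lt_geF // addr_gt0.
Qed.

(** Self-adjoint operators that span the operators on [U]. *)
Definition sa_basis (j : 'I_4) : 'B(U) :=
  [:: E 0 0; E 1 1; E 0 1 + E 1 0; 'i *: E 0 1 + (- 'i) *: E 1 0]`_j.

Lemma sa_basis_selfadj j : selfadj (sa_basis j).
Proof.
apply/selfadjP => u v; have braE i l : '<[E i l u, v]> = '<[u, E l i v]>.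
  by rewrite adjP adj_ketbra.
case: j => [[|[|[|[]]]] // j4]; rewrite /sa_basis [_`_ _]/=.
- exact: braE.
- exact: braE.
- by rewrite !bopD innerDl innerDr !braE addrC.
- rewrite !bopD !bopZ innerDl innerDr !(innerZl 'i, innerZl (- 'i)).
  rewrite !(innerZr 'i, innerZr (- 'i)) !braE.
  by rewrite rmorphN /= conjCi opprK addrC.
Qed.

Lemma conj_op_not_channel (Phi : 'B(U) -> 'B(U)) :
  linear Phi -> (forall j, Phi (sa_basis j) = conj_op eB (sa_basis j)) ->
  ~ completely_positive Phi.
Proof.
move=> lPhi PhiB; apply: swap_not_completely_positive.
have PhiZD c S T : Phi (c *: S + T) = c *: Phi S + Phi T by exact: lPhi.
have Phi0 : Phi 0 = 0.
  by have := PhiZD (-1) 0 0; rewrite scaler0 addr0 scaleN1r addNr.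
have PhiZ c S : Phi (c *: S) = c *: Phi S.
  by have := PhiZD c S 0; rewrite Phi0 !addr0.
have PhiD S T : Phi (S + T) = Phi S + Phi T.
  by have := PhiZD 1 S T; rewrite !scale1r.
have PE0 : Phi (E 0 0) = E 0 0.
  by have := PhiB 0; rewrite /sa_basis /= conj_op_ketbra.
have PE1 : Phi (E 1 1) = E 1 1.
  by have := PhiB 1; rewrite /sa_basis /= conj_op_ketbra.
have conjZ c i j : conj_op eB (c *: E i j) = Num.conj c *: E i j.
  rewrite -[c *: _]addr0 conj_opP conj_op_ketbra -[RHS]addr0; congr (_ + _).
  by apply/bop_eqP => u; exact: conjv0.
have PX : Phi (E 0 1) + Phi (E 1 0) = E 1 0 + E 0 1.
  have := PhiB 2%:R; rewrite /sa_basis /= PhiD -[E 0 1 in RHS]scale1r.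
  by rewrite conj_opP rmorph1 scale1r !conj_op_ketbra [RHS]addrC.
have PY : Phi (E 0 1) - Phi (E 1 0) = E 1 0 - E 0 1.
  have := PhiB 3%:R; rewrite /sa_basis /= PhiD !PhiZ conj_opP conjZ.
  rewrite conj_op_ketbra rmorphN /= conjCi opprK !scaleNr -scalerBr [RHS]addrC.
  by rewrite -scalerBr; apply: scalerI; exact: neq0Ci.
have two0 : 2%:R != 0 :> R[i] by rewrite pnatr_eq0.
have PE01 : Phi (E 0 1) = E 1 0.
  apply: (scalerI two0); rewrite !scaler_nat !mulr2n.
  have := congr2 +%R PX PY; rewrite addrACA subrr addr0 => ->.
  by rewrite addrACA subrr addr0.
have PE10 : Phi (E 1 0) = E 0 1 by move: PX; rewrite PE01 => /addrI.
have two (i : 'I_2) : i = 0 \/ i = 1.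
  by case: i => [[|[|//]] i2]; [left|right]; apply: val_inj.
by move=> i j; case: (two i) => ->; case: (two j) => ->.
Qed.
End Transpose.

Theorem proposition8p2 (R : realType) (H : dimn -> hilbertType R)
    (e : forall n : dimn, basis_index n -> H n)
    (e_basis : forall n : dimn, hilbert_basis (e n)) :
  exists (k d : nat) (a b : nctuple H k (Fin d)),
  [/\ (0 < k)%N,
      forall j : 'I_k, selfadj (a j) /\ selfadj (b j),
      forall r : R, 0 < r ->
        nc_ball r a -> nc_ball r b ->
        forall (l : nat) (h : 'I_l -> ncfun H k),
        (forall i : 'I_l, cont_affine r (h i)) ->
        forall G : mvfun H k, multivalued_nc r G ->
        (forall (m : nat) (x : nctuple H k (Fin m)), nc_ball r x ->
          G (Fin m) x =
          [set al | selfadj al /\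
                    forall i : 'I_l, le_op (h i (Fin m) x) al]) ->
        le_set [set ntrace (e (Fin d)) al | al in G (Fin d) a]
               [set ntrace (e (Fin d)) al | al in G (Fin d) b] &
      ~ exists Phi : 'B(H (Fin d)) -> 'B(H (Fin d)),
          unital_quantum_channel (e (Fin d)) Phi /\
          forall j : 'I_k, Phi (b j) = a j].
Proof.
have eB : @hilbert_basis R (H (Fin 1)) 'I_2 (e (Fin 1)) := e_basis (Fin 1).
exists 4, 1, (fun j => conj_op eB (sa_basis (e (Fin 1)) j)),
  (sa_basis (e (Fin 1))); split=> //.
- by move=> j; split; [apply: conj_op_selfadj|]; apply: sa_basis_selfadj.
- move=> r _ ar br l h hA G _ GE _ [al + <-].
  rewrite GE // => -[sal hal].
  exists (ntrace (e (Fin 1)) (conj_op eB al)); last by rewrite ntrace_conj_op.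
  exists (conj_op eB al) => //; rewrite GE //; split.
    exact: conj_op_selfadj.
  move=> i; have [_ hc _] := hA i.
  apply: (le_op_conj_op (e_basis (Fin 0)) hc ar br) => // j.
  exact: sa_basis_selfadj.
- move=> [Phi [[lPhi cpPhi _ _] Phib]].
  exact: (conj_op_not_channel lPhi Phib).
Qed.
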